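(* Let $N\ge2$ and $1\le a\le N-1$ be integers, and let $K=\{k_0,\dots,k_a\}\subset\{1,\ldots,N\}$ with $k_0<\dots<k_a$. Then $$ \mathcal M^a_{N}(x_1,\dots,x_N)=\sum_{\substack{J\subseteq K\\ J\neq\emptyset}}(-1)^{|J|-1}\det(N_J)\,\mathcal M^a_{N-|J|}\big(\{x_k\}_{k\in\{1,\dots,N\}\setminus J}\big) $$ as operators on rational functions in $x_1,\dots,x_N$.
   Context: Let $q,t$ be formal parameters and $x_1,\dots,x_N$ independent variables. $\Gamma_i$ denotes the $q$-shift operator replacing $x_i$ by $q x_i$ and fixing the other variables, and $\Gamma_I=\prod_{i\in I}\Gamma_i$. Rational functions act by multiplication. For a finite index set $A\subset\{1,\dots,N\}$, the level-$a$ Macdonald operator in the variables $\{x_k\}_{k\in A}$ is $$ \mathcal M^a_{|A|}(\{x_k\}_{k\in A}):=t^{\binom a2}\sum_{\substack{I\subset A\\ |I|=a}}\Bigg(\prod_{i\in I}\prod_{j\in A\setminus I}\frac{t x_i-x_j}{x_i-x_j}\Bigg)\Gamma_I , $$ with $\mathcal M^a_N(x_1,\dots,x_N)$ the case $A=\{1,\dots,N\}$; it is $0$ (empty sum) if $|A|<a$. For distinct $i,j\in K$ put $f_{ij}=\frac{t x_j-x_i}{x_j-x_i}$. For nonempty $J\subseteq K$, $N_J$ is the $|J|\times|J|$ matrix with rows and columns indexed by $J$ and entries $$ N_{ii}=\prod_{k\in K\setminus\{i\}}f_{ik},\qquad N_{ij}=(f_{ij}-1)\prod_{k\in K\setminus\{i,j\}}f_{ik}\quad(i\neq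 j). $$ Empty products equal $1$. *)

(* Defs.v *)
From HB Require Import structures.
From mathcomp Require Import all_boot all_order all_algebra fraction.
From mathcomp Require Import generic_quotient.
From mathcomp Require Import mpoly.

Set Implicit Arguments.
Unset Strict Implicit.
Unset Printing Implicit Defensive.

Import GRing.Theory.
Local Open Scope ring_scope.
Local Open Scope quotient_scope.

Notation "x %:F" := (@FracField.tofrac _ x) : ring_scope.

(* k(q, t), where 'X_0 is q and 'X_1 is t. *)
Notation qtfield k := {fraction {mpoly k[2]}}.

Definition q_par (k : fieldType) : qtfield k := ('X_ord0)%:F.
Definition t_par (k : fieldType) : qtfield k := ('X_ord_max)%:F.

Notation ratfun F N := {fraction {mpoly F[N]}}.

Section Operators.

Variables (F : fieldType) (N : nat).
Implicit Types (q t : F) (i j : 'I_N) (A I J K : {set 'I_N}).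

Definition x_ i : ratfun F N := ('X_i)%:F.
Definition cst (c : F) : ratfun F N := (c%:MP)%:F.

Definition qshift_poly q i (p : {mpoly F[N]}) : {mpoly F[N]} :=
  p \mPo [tuple if j == i then q *: 'X_j else 'X_j | j < N].

(* For q != 0 the value does not depend on the chosen numerator and
   denominator: see Gamma_frac. *)
Definition Gamma q i (g : ratfun F N) : ratfun F N :=
  (qshift_poly q i \n_(repr g))%:F / (qshift_poly q i \d_(repr g))%:F.

Definition Gamma_set q I : ratfun F N -> ratfun F N :=
  \big[comp/id]_(i in I) Gamma q i.

Definition Macdonald q t (a : nat) A (g : ratfun F N) : ratfun F N :=
  cst t ^+ 'C(a, 2) *
  \sum_(I : {set 'I_N} | (I \subset A) && (#|I| == a))
    (\prod_(i in I) \prod_(j in A :\: I)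
        ((cst t * x_ i - x_ j) / (x_ i - x_ j))) * Gamma_set q I g.

Definition fcoef t i j : ratfun F N :=
  (cst t * x_ j - x_ i) / (x_ j - x_ i).

Definition Nentry t K i j : ratfun F N :=
  if i == j then \prod_(k in K :\ i) fcoef t i k
  else (fcoef t i j - 1) * \prod_(k in K :\: [set i; j]) fcoef t i k.

(* Rows and columns are indexed by J through its increasing enumeration. *)
Definition Nmx t K J : 'M[ratfun F N]_#|J| :=
  \matrix_(r, s) Nentry t K (enum_val r) (enum_val s).

Lemma qshift_polyM q i : {morph qshift_poly q i : p r / p * r}.
Proof. by move=> p r; rewrite /qshift_poly rmorphM. Qed.

Lemma qshift_polyK q i : q != 0 ->
  cancel (qshift_poly q i) (qshift_poly q^-1 i).
Proof.
move=> q0 p; rewrite /qshift_poly (comp_mpolyEX p) raddf_sum /=.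
rewrite [RHS]mpolyE; apply: eq_bigr => m _.
rewrite comp_mpolyZ; congr (_ *: _).
rewrite comp_mpolyX rmorph_prod /= mpolyXE_id; apply: eq_bigr => j _.
rewrite rmorphXn /= tnth_mktuple; congr (_ ^+ _).
case: ifP => [/eqP->|ji].
  by rewrite comp_mpolyZ comp_mpolyXU nth_mktuple eqxx scalerA mulfV // scale1r.
by rewrite comp_mpolyXU nth_mktuple ji.
Qed.

Lemma qshift_poly_eq0 q i p : q != 0 -> (qshift_poly q i p == 0) = (p == 0).
Proof.
move=> q0; have h0 r : qshift_poly r i 0 = 0 by rewrite /qshift_poly comp_mpoly0.
apply: (sameP eqP); apply: (iffP eqP) => [->|e]; first exact: h0.
by rewrite -(qshift_polyK i q0 p) e h0.
Qed.

Lemma frac_numden (R : idomainType) (g : {fraction R}) :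
  g = (\n_(repr g))%:F / (\d_(repr g))%:F.
Proof.
have d0 : (\d_(repr g))%:F != 0 :> {fraction R}.
  by rewrite tofrac_eq0 denom_ratioP.
apply: (mulIf d0); rewrite mulfVK //.
rewrite -{1}[g]reprK; move: (repr g) => r {d0}.
unlock FracField.tofrac; rewrite -[LHS]FracField.pi_mul.
apply/eqP; rewrite FracField.equivf_def /FracField.equivf /FracField.mulf /=.
by rewrite !numden_Ratio ?mulr1 ?oner_neq0 ?denom_ratioP // mulrC.
Qed.

Lemma Gamma_frac q i (n d : {mpoly F[N]}) : q != 0 -> d != 0 ->
  Gamma q i (n%:F / d%:F) = (qshift_poly q i n)%:F / (qshift_poly q i d)%:F.
Proof.
move=> q0 d0; rewrite /Gamma; set g := n%:F / d%:F.
have dg0 : \d_(repr g) != 0 by rewrite denom_ratioP.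
have /eqP := frac_numden g; rewrite {1}/g eqr_div ?tofrac_eq0 //.
rewrite -!tofracM tofrac_eq => /eqP e.
apply/eqP; rewrite eqr_div ?tofrac_eq0 ?qshift_poly_eq0 //.
by rewrite -!tofracM -!qshift_polyM e.
Qed.

End Operators.

(* Main.v *)
Require Import Defs.
From mathcomp Require Import all_boot all_order all_algebra fraction.
From mathcomp Require Import perm mpoly ring.

Import GRing.Theory.
Local Open Scope ring_scope.

(** Both sides are linear combinations of the shifts [Gamma_I], [#|I| = a], and
    the identity holds coefficient by coefficient.  Write
    [f j i = (t x_i - x_j) / (x_i - x_j)], [g j = \prod_(i in I) f j i] and
    [L = K \ I], so that [J] contributes to the coefficient of [Gamma_I] exactly
    when [J] is contained in [L].  After moving the left-hand side into the sum
    as the [J = set0] term, what must be shown is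
    [[
      \sum_(J \subset L) (-1)^#|J| \det(N_J) \prod_(j notin I, j notin J) g j = 0.
    ]]
    By the expansion of a determinant into principal minors ([det_diag_add])
    the sum is, up to the factors [g j] with [j] outside [I] and [L], the
    determinant of [diag(g) - N] restricted to [L], so it suffices that this
    matrix is singular, i.e. that [N] restricted to [L] maps some nonzero vector
    [v] to [diag(g) v].

    Such a vector is explicit ([kervec]):
    [[
      v l = \prod_(i in I) (x_i - x_l) / (x_l \prod_(k in K, k != l) (x_k - x_l)).
    ]]
    It vanishes at [l \in K :&: I], so the sum over [L] defining [N v] may be
    taken over all of [K].  The diagonal and off-diagonal entries of [N] have a
    common product form ([NcoefE]), and it turns [(N v) j] into the Lagrange
    interpolation at the nodes [t x_l], [l \in K], of the polynomial
    [\prod_(i in I) (t x_i - z)], evaluated at [z = x_j] ([kervec_eigen]).  The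
    degree [#|I| = #|K| - 1] is just small enough for interpolation to be exact,
    which is where the cardinality of [K] enters.  Finally [#|K| > #|I|] makes
    [L] nonempty, and [v] has no zero on [L]. *)

Set Implicit Arguments.
Unset Strict Implicit.

(** * Principal minor expansion of a determinant *)

Lemma det_mx_dim0 (R : comPzRingType) n (A : 'M[R]_n) : n = 0 -> \det A = 1.
Proof. by case: n A => [|n] A // _; exact: det_mx00. Qed.

(** Multilinearity in the rows, all rows expanded at once. *)
Lemma det_add (R : comPzRingType) n (A B : 'M[R]_n) :
  \det (A + B) =
  \sum_(J : {set 'I_n}) \det (\matrix_(i, j) if i \in J then A i j else B i j).
Proof.
rewrite /determinant exchange_big /=; apply: eq_bigr => s _.
rewrite -big_distrr /=; congr (_ * _).
under eq_bigr do rewrite mxE.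
rewrite bigA_distr; apply: eq_bigr => J _.
by apply: eq_bigr => i _; rewrite mxE.
Qed.

(** Simultaneous reindexing of rows and columns: the two signatures cancel. *)
Lemma det_mxsub_bij (R : comPzRingType) m n (f : 'I_m -> 'I_n) (A : 'M[R]_n) :
  bijective f -> \det (mxsub f f A) = \det A.
Proof.
move=> fbij; have emn : m = n by have := bij_eq_card fbij; rewrite !card_ord.
case: n / emn f A fbij => f A /bij_inj finj.
have -> : mxsub f f A = row_perm (perm finj) (col_perm (perm finj) A).
  by apply/matrixP=> i j; rewrite !mxE !permE.
rewrite row_permE col_permE !det_mulmx !det_perm odd_permV mulrC -mulrA.
by rewrite -signr_addb addbb mulr1.
Qed.

(** Listing the indices in [J] first makes the matrix block upper triangular,
    with diagonal lower right block. *)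
Lemma det_diag_rows (R : comPzRingType) n (A : 'M[R]_n) (d : 'rV[R]_n)
    (J : {set 'I_n}) :
  \det (\matrix_(i, j) if i \in J then A i j else diag_mx d i j) =
  \det (mxsub (@enum_val _ (mem J)) (@enum_val _ (mem J)) A)
  * \prod_(i in ~: J) d 0 i.
Proof.
set B := \matrix_(i, j) _.
pose f (r : 'I_(#|J| + #|~: J|)) : 'I_n :=
  match split r with inl u => enum_val u | inr u => enum_val u end.
have fl u : f (lshift _ u) = enum_val u.
  by rewrite /f (unsplitK (inl u)).
have fr u : f (rshift _ u) = enum_val u.
  by rewrite /f (unsplitK (inr u)).
have inJ (u : 'I_#|J|) : enum_val u \in J by exact: enum_valP.
have outJ (u : 'I_#|~: J|) : (enum_val u \in J) = false.
  by have := enum_valP u; rewrite inE => /negbTE.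
have finj : injective f.
  move=> r s; case: (split_ordP r) => u ->; case: (split_ordP s) => w ->.
  - by rewrite !fl => /enum_val_inj->.
  - by rewrite fl fr => e; have := inJ u; rewrite e outJ.
  - by rewrite fl fr => e; have := inJ w; rewrite -e outJ.
  - by rewrite !fr => /enum_val_inj->.
have fbij : bijective f.
  by apply: inj_card_bij finj _; rewrite !card_ord cardsC card_ord.
rewrite -(det_mxsub_bij B fbij).
have -> : mxsub f f B =
    block_mx (mxsub (@enum_val _ (mem J)) (@enum_val _ (mem J)) A)
      (mxsub (@enum_val _ (mem J)) (@enum_val _ (mem (~: J))) A)
      0 (diag_mx (\row_u d 0 (enum_val u))).
  apply/matrixP => r s; rewrite mxE.
  case: (split_ordP r) => u ->; case: (split_ordP s) => w ->;
    rewrite ?block_mxEul ?block_mxEur ?block_mxEdl ?block_mxEdr ?fl ?fr !mxE;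
    rewrite ?inJ ?outJ //.
  - by case: eqP => // e; have := inJ w; rewrite -e outJ.
  - by rewrite (inj_eq enum_val_inj).
rewrite det_ublock det_diag; congr (_ * _).
rewrite [RHS](big_enum_val (fun i => d 0 i)) /=.
by apply: eq_bigr => u _; rewrite mxE.
Qed.

Lemma det_diag_add (R : comPzRingType) n (A : 'M[R]_n) (d : 'rV[R]_n) :
  \det (diag_mx d + A) =
  \sum_(J : {set 'I_n})
    \det (mxsub (@enum_val _ (mem J)) (@enum_val _ (mem J)) A)
    * \prod_(i in ~: J) d 0 i.
Proof. by rewrite addrC det_add; apply: eq_bigr => J _; rewrite det_diag_rows. Qed.

(** * Lagrange interpolation *)

(** The difference of both sides, as a polynomial in [z], has degree less than
    [#|K|] and vanishes at the [#|K|] nodes. *)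
Lemma lagrange_interpolation (F : fieldType) (T : finType) (K : {set T})
    (y : T -> F) (p : {poly F}) (z : F) :
  {in K &, injective y} -> (size p <= #|K|)%N ->
  p.[z] = \sum_(l in K) p.[y l] * \prod_(k in K :\ l) ((y k - z) / (y k - y l)).
Proof.
move=> yinj sp.
(* The fundamental polynomials: [b l] is 1 at [y l] and 0 at the other nodes. *)
pose b l := \prod_(k in K :\ l) ((y k - y l)^-1 *: ((y k)%:P - 'X)).
have hb l w : (b l).[w] = \prod_(k in K :\ l) ((y k - w) / (y k - y l)).
  by rewrite horner_prod; apply: eq_bigr => k _; rewrite !hornerE mulrC.
have sb l : l \in K -> (size (b l) <= #|K|)%N.
  move=> lK; rewrite (cardsD1 l K) lK add1n /b -sum1_card.
  elim/big_rec2: _ => [|k m r _ IH]; first by rewrite size_poly1.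
  apply: leq_trans (size_polyMleq _ _) _.
  have h : (size ((y k - y l)^-1 *: ((y k)%:P - 'X)) <= 2)%N.
    apply: leq_trans (size_scale_leq _ _) _.
    by rewrite -opprB size_polyN size_XsubC.
  by rewrite -subn1 leq_subLR; apply: leq_trans (leq_add h IH) _.
pose D := p - \sum_(l in K) p.[y l] *: b l.
suff D0 : D = 0.
  have : D.[z] = 0 by rewrite D0 horner0.
  rewrite /D hornerD hornerN => /eqP; rewrite subr_eq0 => /eqP->.
  by rewrite horner_sum; apply: eq_bigr => l _; rewrite hornerZ hb.
have sD : (size D <= #|K|)%N.
  apply: leq_trans (size_polyD _ _) _; rewrite geq_max sp size_polyN.
  apply: leq_trans (size_sum _ _ _) _; apply/bigmax_leqP => l lK.
  by apply: leq_trans (size_scale_leq _ _) (sb l lK).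
apply/eqP; apply: contraT => nzD.
have := max_poly_roots (rs := [seq y l | l <- enum K]) nzD.
rewrite size_map -cardE ltnNge sD; apply.
  apply/allP => w /mapP [l]; rewrite mem_enum => lK ->.
  rewrite rootE /D hornerD hornerN subr_eq0 horner_sum (bigD1 l) //= hornerZ hb.
  rewrite [X in _ * X]big1 => [|k]; last first.
    rewrite !inE => /andP[kl kK]; rewrite divff // subr_eq0.
    by apply: contra kl => /eqP /yinj ->.
  rewrite mulr1 big1 ?addr0 // => k /andP[kK kl].
  rewrite hornerZ hb (bigD1 l) ?inE ?lK 1?eq_sym ?kl //=.
  by rewrite subrr !mul0r mulr0.
rewrite map_inj_in_uniq ?enum_uniq // => l m; rewrite !mem_enum; exact: yinj.
Qed.

(** * The coefficient of one shift *)

Section Coefficient.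

Variables (E : fieldType) (n : nat) (t : E) (x : 'I_n -> E).
Hypotheses (t0 : t != 0) (x0 : forall i, x i != 0) (xinj : injective x).
Variables (K I : {set 'I_n}).
Hypothesis cardKI : #|K| = #|I|.+1.

Let f i j := (t * x j - x i) / (x j - x i).
Let Ncoef i j := if i == j then \prod_(k in K :\ i) f i k
  else (f i j - 1) * \prod_(k in K :\: [set i; j]) f i k.

Lemma subr_x_neq0 i j : i != j -> x i - x j != 0.
Proof. by rewrite subr_eq0; apply: contra => /eqP/xinj->. Qed.

(** One formula for all entries: for [l = j] the factors [x l / x j] cancel, and
    for [l != j] the factor [k = j] of the numerator is [(t - 1) * x j], which
    combines with [f j l - 1 = (t - 1) * x l / (x l - x j)]. *)
Lemma NcoefE j l : j \in K -> l \in K ->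
  Ncoef j l = x l / x j * (\prod_(k in K :\ l) (t * x k - x j)
                / \prod_(k in K :\ j) (x k - x j)).
Proof.
move=> jK lK; rewrite /Ncoef; case: eqP => [<-|/eqP jl].
  by rewrite divff // mul1r prodf_div.
have ljK : l \in K :\ j by rewrite !inE eq_sym jl.
have jlK : j \in K :\ l by rewrite !inE jl.
rewrite (big_setD1 l ljK) (big_setD1 j jlK) /= prodf_div.
have -> : K :\: [set j; l] = (K :\ j) :\ l.
  by apply/setP=> k; rewrite !inE negb_or; case: (k == l); case: (k == j).
have -> : (K :\ l) :\ j = (K :\ j) :\ l.
  by apply/setP=> k; rewrite !inE; case: (k == l); case: (k == j).
have h : x l - x j != 0 by rewrite subr_x_neq0 // eq_sym.
have -> : f j l - 1 = (t - 1) * x l / (x l - x j).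
  apply: (mulIf h); rewrite mulrBl /f !divfK // mul1r mulrBl mul1r.
  by rewrite opprB addrA addrNK.
have -> : t * x j - x j = (t - 1) * x j by rewrite mulrBl mul1r.
rewrite invfM.
set u := \prod_(_ in _) _; set w := (\prod_(_ in _) _)^-1.
rewrite (mulrC (t - 1) (x l)) (mulrC (t - 1) (x j)) -!mulrA.
congr (_ * _); rewrite mulKf //; congr (_ * _).
by rewrite mulrCA.
Qed.

Definition kervec l :=
  \prod_(i in I) (x i - x l) / (x l * \prod_(k in K :\ l) (x k - x l)).

(** The left-hand side is, up to a factor depending only on [j], the Lagrange
    interpolation at the nodes [t * x l], [l \in K], of
    [\prod_(i in I) (t * x i - 'X)], evaluated at [x j].  The nodes with
    [l \in I] are roots of this polynomial, hence a sum over [K :\: I] only. *)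
Lemma kervec_eigen j : j \in K :\: I ->
  \sum_(l in K :\: I) Ncoef j l * kervec l =
  (\prod_(i in I) f j i) * kervec j.
Proof.
rewrite inE => /andP[jI jK].
pose S : {poly E} := \prod_(i in I) ((t * x i)%:P - 'X).
have hS z : S.[z] = \prod_(i in I) (t * x i - z).
  by rewrite horner_prod; apply: eq_bigr => i _; rewrite !hornerE.
have sS : (size S <= #|K|)%N.
  rewrite cardKI /S -sum1_card.
  elim/big_rec2: _ => [|k m r _ IH]; first by rewrite size_poly1.
  apply: leq_trans (size_polyMleq _ _) _.
  rewrite -opprB size_polyN size_XsubC.
  by rewrite -subn1 leq_subLR; apply: leq_trans (leq_add (leqnn 2) IH) _.
have yinj : {in K &, injective (fun i => t * x i)}.
  by move=> i k _ _ /(mulfI t0) /xinj.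
have := lagrange_interpolation (x j) yinj sS.
rewrite hS => e.
have -> : (\prod_(i in I) f j i) * kervec j =
   (\prod_(i in I) (t * x i - x j)) / (x j * \prod_(k in K :\ j) (x k - x j)).
  rewrite /kervec /f prodf_div mulrA divfK //.
  apply/prodf_neq0 => i iI; apply: subr_x_neq0; apply: contraNneq jI => <- //.
rewrite e big_distrl [RHS](bigID (mem I)) /= [X in X + _]big1 ?add0r; last first.
  move=> l /andP[lK lI]; rewrite hS (bigD1 l) //= subrr.
  by rewrite !mul0r.
apply: eq_big => [l|l]; first by rewrite inE andbC.
rewrite inE => /andP[lI lK]; rewrite NcoefE // hS /kervec.
under [in RHS]eq_bigr do rewrite -mulrBr.
under [X in _ * X / _]eq_bigr do rewrite -mulrBr invfM mulrCA.
rewrite !big_split /= !prodr_const prodfV.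
have -> : #|K :\ l| = #|I|.
  by have := cardsD1 l K; rewrite lK cardKI add1n => -[].
rewrite exprVn.
set u := \prod_(i in I) _; set p := \prod_(_ in _) (_ - _).
set r := \prod_(_ in _) _; set w := \prod_(_ in _) _.
have T0 : t ^+ #|I| != 0 by rewrite expf_neq0.
rewrite [X in _ = X / _]mulrACA divff // mul1r !invfM -[RHS]mul1r -(divff (x0 l)).
by ring.
Qed.

(** The sum is the determinant of the matrix with rows [d i e_i - N_i] for [i] in
    [K :\: I] and [d i e_i] otherwise, where [d i = \prod_(k in I) f i k] off [I];
    [kervec], extended by zero outside [K :\: I], is in its kernel.  The zero
    rows of [A] outside [K :\: I] kill all principal minors other than those
    in the sum. *)
Lemma minor_sum_eq0 :
  \sum_(J : {set 'I_n} | J \subset K :\: I)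
    (-1) ^+ #|J| * \det (\matrix_(r < #|J|, s < #|J|)
       Ncoef (enum_val r) (enum_val s))
    * \prod_(j in ~: (I :|: J)) \prod_(i in I) f j i = 0.
Proof.
pose L := K :\: I.
pose A : 'M[E]_n := \matrix_(i, j) if i \in L then - Ncoef i j else 0.
(* On [I] the value 1 removes these indices from the products of [d]. *)
pose d : 'rV[E]_n := \row_i if i \in I then 1 else \prod_(k in I) f i k.
have det0 : \det (diag_mx d + A) = 0.
  (* [det0P] speaks of row vectors, hence the transpose. *)
  rewrite -det_tr; apply/eqP/det0P.
  exists (\row_l if l \in L then kervec l else 0).
    have : (0 < #|L|)%N.
      rewrite /L; have := cardsID I K; have := subset_leq_card (subsetIr K I).
      rewrite cardKI => h; case: #|K :\: I| => //; rewrite addn0 => e.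
      by rewrite e ltnn in h.
    case/card_gt0P => l lL; apply/negP => /eqP/rowP/(_ l).
    rewrite !mxE lL => /eqP; apply/negP.
    move: lL; rewrite inE => /andP[lI lK].
    rewrite /kervec mulf_neq0 ?invr_eq0 ?mulf_neq0 //; apply/prodf_neq0 => i.
      by move=> iI; apply: subr_x_neq0; apply: contraNneq lI => <-.
    by rewrite !inE => /andP[il _]; apply: subr_x_neq0.
  apply/rowP => j; rewrite !mxE.
  under eq_bigr do rewrite !mxE mulrDr.
  rewrite big_split /= (bigD1 j) //= eqxx mulr1n [X in _ + X + _]big1 ?addr0; last first.
    by move=> i ij; rewrite eq_sym (negbTE ij) mulr0.
  case: ifP => jL; last by rewrite mul0r add0r big1 // => i _; rewrite mulr0.
  have /negbTE-> : j \notin I by move: jL; rewrite inE => /andP[].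
  rewrite mulrC -kervec_eigen // -/L big_mkcond -big_split /= big1 // => l _.
  by case: ifP => _; rewrite ?mul0r ?addr0 // mulrN mulrC subrr.
rewrite -[RHS]det0 det_diag_add [RHS](bigID (fun J : {set _} => J \subset L)) /=.
rewrite [X in _ + X]big1 ?addr0 => [|J].
  apply: eq_bigr => J JL; congr (_ * _).
    rewrite -detZ; congr (\det _); apply/matrixP => r s; rewrite !mxE mulN1r.
    by rewrite (subsetP JL) // enum_valP.
  rewrite [RHS](bigID (mem I)) /= [X in X * _]big1 ?mul1r => [|i]; last first.
    by rewrite mxE => /andP[_ ->].
  apply: eq_big => [i|i]; first by rewrite !inE negb_or andbC.
  by rewrite !inE negb_or mxE => /andP[/negbTE-> _].
case/subsetPn => i iJ iL.
rewrite (expand_det_row _ (enum_rank_in iJ i)) big1 ?mul0r // => s _.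
by rewrite !mxE enum_rankK_in // (negbTE iL) mul0r.
Qed.

(** Isolating the empty minor in [minor_sum_eq0]. *)
Lemma shift_coefficient :
  \prod_(j in ~: I) \prod_(i in I) f j i =
  \sum_(J : {set 'I_n} | (J \subset K :\: I) && (J != set0))
    (-1) ^+ #|J|.-1 * \det (\matrix_(r < #|J|, s < #|J|)
       Ncoef (enum_val r) (enum_val s))
    * \prod_(j in ~: (I :|: J)) \prod_(i in I) f j i.
Proof.
have /eqP := minor_sum_eq0; rewrite (bigD1 set0) ?sub0set //=.
rewrite [X in _ * X * _]det_mx_dim0 ?cards0 // mulr1 expr0 mul1r setU0.
rewrite addr_eq0 => /eqP ->; rewrite -sumrN.
apply: eq_bigr => J /andP[_ J0]; rewrite -!mulNr; congr (_ * _ * _).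
by rewrite -[in LHS](@prednK #|J|) ?card_gt0 // exprS mulN1r opprK.
Qed.

End Coefficient.

(** * The Macdonald operator identity *)

Lemma mpolyXU_eq0 (R : nzRingType) n (i : 'I_n) :
  ('X_i == 0 :> {mpoly R[n]}) = false.
Proof.
apply/eqP => /(congr1 (mcoeff U_(i))) /eqP.
by rewrite mcoeff0 mcoeffXU eqxx oner_eq0.
Qed.

Unset Implicit Arguments.
Set Strict Implicit.

Theorem mainTheorem7 (k : fieldType) (N a : nat) (K : {set 'I_N}) :
  (2 <= N)%N -> (1 <= a <= N.-1)%N -> #|K| = a.+1 ->
  forall g : ratfun (qtfield k) N,
    Macdonald (q_par k) (t_par k) a [set: 'I_N] g =
    \sum_(J : {set 'I_N} | (J \subset K) && (J != set0))
      (-1) ^+ (#|J|.-1) * \det (Nmx (t_par k) K J)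
      * Macdonald (q_par k) (t_par k) a (~: J) g.
Proof.
move=> _ _ cardK g; rewrite /Macdonald.
set c := cst N (t_par k) ^+ _.
under [RHS]eq_bigr do rewrite mulrCA.
rewrite -big_distrr /=; congr (_ * _).
under [RHS]eq_bigr do rewrite big_distrr /=.
(* With [I] outermost, the coefficients of each shift can be compared. *)
rewrite [RHS](exchange_big_dep (fun I : {set 'I_N} => #|I| == a)) /=; last first.
  by move=> J I _ /andP[].
apply: eq_big => [I|I /andP[_ /eqP cI]]; first by rewrite subsetT.
under [RHS]eq_bigr do rewrite mulrA.
rewrite -big_distrl /=; congr (_ * _).
have t0 : cst N (t_par k) != 0.
  by rewrite /cst tofrac_eq0 mpolyC_eq0 /t_par tofrac_eq0 mpolyXU_eq0.
have x0 (i : 'I_N) : x_ (qtfield k) i != 0 by rewrite /x_ tofrac_eq0 mpolyXU_eq0.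
have xinj : injective (@x_ (qtfield k) N).
  move=> i j /eqP; rewrite /x_ tofrac_eq => /eqP/(congr1 (mcoeff U_(j))) /eqP.
  by rewrite !mcoeffXU eqxx; case: (i =P j) => // _; rewrite eq_sym oner_eq0.
have cKI : #|K| = #|I|.+1 by rewrite cI.
have := shift_coefficient t0 x0 xinj cKI.
rewrite setTD exchange_big /= => ->.
apply: eq_big => [J|J /andP[JKI J0]].
  by rewrite cI eqxx andbT subsetD -disjoints_subset disjoint_sym andbAC.
have -> : ~: J :\: I = ~: (I :|: J) by rewrite setCU setIC setDE.
by rewrite [in RHS]exchange_big.
Qed.
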